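(* Let $\epsilon>0$. Suppose the DRO problem (defined in the context) has a finite optimal value, every invoked master problem MP-DRO attains a finite optimum, and, whenever Step 3 of the BiCS algorithm is invoked at an incumbent $\boldsymbol x$, the oracle returns, for each $m\in[M]$, a feasible finite-support distribution $\tilde{\mathbb P}_m^*\in\mathcal P_m$ satisfying $$\Omega_m^*(\boldsymbol x)-\epsilon/2\le\hat\Omega_m(\boldsymbol x):=\mathbb E_{\tilde{\mathbb P}_m^*}[f_m(\boldsymbol a_m,\boldsymbol x)]\le\Omega_m^*(\boldsymbol x).$$ If the BiCS algorithm terminates by the Step 4 stopping criterion, it returns an $\epsilon$-optimal solution to the DRO problem. Moreover, if $\mathcal{X}$ is compact and, for each $m\in[M]$, $f_m$ is jointly continuous on $\mathcal{A}_m\times\mathcal{X}$ and the supporting scenarios of the distributions added in Step 3 lie in a compact subset $\mathcal{C}_m\subseteq\mathcal{A}_m$ uniformly over generated incumbents, then the BiCS algorithm terminates in a finite number of iterations.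
   Context: **Problem.** $[M]=\{1,\dots,M\}$, $\mathcal X\subseteq\mathbb R^n$, $\boldsymbol c\in\mathbb R^n$, $\boldsymbol b\in\mathbb R^M$. For each $m\in[M]$: $\mathcal A_m\subseteq\mathbb R^n$ is the sample space with Borel $\sigma$-algebra $\mathcal F_m$; $f_m:\mathcal A_m\times\mathcal X\to\mathbb R$; and, for finitely many measurable functions $g_t:\mathcal A_m\to\mathbb R$, $t\in[T_m]$ (which may depend on $m$) and scalars $\gamma_{mt}\in\mathbb R$, the ambiguity set is $$\mathcal P_m=\{\mathbb P \text{ nonnegative measure on }(\mathcal A_m,\mathcal F_m):\ \mathbb P(\mathcal A_m)=1,\ \mathbb E_{\mathbb P}[g_t^-]<\infty,\ \mathbb E_{\mathbb P}[g_t]\le\gamma_{mt}\ \forall t\in[T_m]\},$$ where $g_t^-=\max\{-g_t,0\}$. The DRO problem is $$\min_{\boldsymbol x\in\mathcal X}\boldsymbol c^\top\boldsymbol x\quad\text{s.t.}\quad\Omega_m^*(\boldsymbol x):=\sup_{\mathbb P_m\in\mathcal P_m}\mathbb E_{\mathbb P_m}[f_m(\boldsymbol a_m,\boldsymbol x)]\le b_m,\ \forall m\in[M].$$ **Standing assumption.** For each $m$, $\mathcal P_m\neq\varnothing$ and: (i) $\mathcal A_m$ is nonempty and closed, $f_m(\cdot,\boldsymbol x)$ is upper semicontinuous on $\mathcal A_m$ for every $\boldsymbol x\in\mathcal X$, and each $g_t$ is lower semicontinuous; (ii) for every $\boldsymbol x\in\mathcal X$ there are scalars $\beta_{0m}(\boldsymbol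 x)\in\mathbb R$, $\beta_{tm}(\boldsymbol x)\ge0$ with $|f_m(\boldsymbol a,\boldsymbol x)|\le\beta_{0m}(\boldsymbol x)+\sum_{t\in[T_m]}\beta_{tm}(\boldsymbol x)|g_t(\boldsymbol a)|$ for all $\boldsymbol a\in\mathcal A_m$. **$\epsilon$-optimality.** $\boldsymbol x\in\mathcal X$ is $\epsilon$-feasible if $\Omega_m^*(\boldsymbol x)\le b_m+\epsilon$ for all $m\in[M]$; it is $\epsilon$-optimal if it is $\epsilon$-feasible and $\boldsymbol c^\top\boldsymbol x$ does not exceed the optimal value of the DRO problem. **BiCS algorithm.** For finite $\hat A\subseteq\mathcal A_m$ let $\mathcal P_m(\hat A)=\{\mathbb P\in\mathcal P_m:\operatorname{supp}(\mathbb P)\subseteq\hat A\}$. - Step 0–1: Fix a tolerance $\epsilon>0$ and, for each $m$, a finite initial scenario set $\hat A_m\subseteq\mathcal A_m$ with $\mathcal P_m(\hat A_m)\ne\varnothing$. - Step 2: Solve the master problem MP-DRO: $\min_{\boldsymbol x\in\mathcal X}\boldsymbol c^\top\boldsymbol x$ s.t. $\max_{\mathbb P_m\in\mathcal P_m(\hat A_m)}\sum_{\boldsymbol a\in\hat A_m}\mathbb P_m(\{\boldsymbol a\})f_m(\boldsymbol a,\boldsymbol x)\le b_m$ for all $m\in[M]$; let $\boldsymbol x^*$ be the optimal solution obtained (the incumbent). - Step 3: For each $m\in[M]$, call an oracle for the subproblem $\Omega_m^*(\boldsymbol x^* )$, which returns a finitely supported $\tilde{\mathbb P}_m^*\in\mathcal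 P_m$ with value $\hat\Omega_m(\boldsymbol x^* )$. If $\hat\Omega_m(\boldsymbol x^* )>b_m+\epsilon/2$, replace $\hat A_m$ by $\hat A_m\cup\operatorname{supp}(\tilde{\mathbb P}_m^* )$ (this distribution is said to be added). - Step 4: If $\max_{m\in[M]}\{\hat\Omega_m(\boldsymbol x^* )-b_m\}\le\epsilon/2$, terminate and return $\boldsymbol x^*$; otherwise return to Step 2. *)

(* Defs.v *)
From HB Require Import structures.
From mathcomp Require Import all_boot all_order all_algebra.
From mathcomp Require Import all_classical all_reals all_analysis.

Set Implicit Arguments.
Unset Strict Implicit.
Unset Printing Implicit Defensive.
Import Order.TTheory GRing.Theory Num.Theory.
Import numFieldNormedType.Exports.
Local Open Scope classical_set_scope.
Local Open Scope ring_scope.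

Definition borel (R : realType) (n : nat) :=
  g_sigma_algebraType (@open 'cV[R]_n).

(* The set A is meant to be closed and P A = 1: Borel probability measures on
   the closed set A are identified with the Borel probability measures P on R^n
   such that P A = 1, and functions on A with functions on R^n that are only
   ever inspected on A. *)
Definition expect (R : realType) (n : nat) (A : set 'cV[R]_n)
    (P : probability (borel R n) R) (h : 'cV[R]_n -> R) : \bar R :=
  (\int[P]_(a in A) (h a)%:E)%E.

Definition supp (R : realType) (n : nat) (P : probability (borel R n) R) :
    set 'cV[R]_n :=
  [set a | forall U : set 'cV[R]_n, open_nbhs a U -> (0 < P U)%E].

(* Mirrors the library's lower_semicontinuous. *)
Definition upper_semicontinuous (X : topologicalType) (R : numFieldType)
    (f : X -> \bar R) : Prop :=
  forall x (a : R), (f x < a%:E)%E ->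
    exists2 V, nbhs x V & forall y, V y -> (f y < a%:E)%E.

Record dro (R : realType) (n M : nat) := Dro {
  decisions : set 'cV[R]_n;
  cost : 'cV[R]_n;
  rhs : 'cV[R]_M;
  sample_space : 'I_M -> set 'cV[R]_n;
  (* loss D m a x is f_m(a, x) *)
  loss : 'I_M -> 'cV[R]_n -> 'cV[R]_n -> R;
  num_moments : 'I_M -> nat;
  moment : forall m, 'I_(num_moments m) -> 'cV[R]_n -> R;
  moment_bound : forall m, 'I_(num_moments m) -> R }.

Definition objective (R : realType) (n M : nat) (D : dro R n M)
    (x : 'cV[R]_n) : R :=
  ((cost D)^T *m x) 0 0.

Definition ambiguity (R : realType) (n M : nat) (D : dro R n M) (m : 'I_M) :
    set (probability (borel R n) R) :=
  [set P : probability (borel R n) R | P (sample_space D m) = 1%E /\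
    forall t : 'I_(num_moments D m),
      (expect (sample_space D m) P (moment t)^\-%R < +oo)%E /\
      (expect (sample_space D m) P (moment t) <= (moment_bound t)%:E)%E].

Definition worst_case (R : realType) (n M : nat) (D : dro R n M) (m : 'I_M)
    (x : 'cV[R]_n) : \bar R :=
  ereal_sup [set expect (sample_space D m) P (fun a => loss D m a x)
            | P in ambiguity D m].

Definition dro_feasible (R : realType) (n M : nat) (D : dro R n M) :
    set 'cV[R]_n :=
  [set x | decisions D x /\
    forall m, (worst_case D m x <= (rhs D m 0)%:E)%E].

Definition dro_value (R : realType) (n M : nat) (D : dro R n M) : \bar R :=
  ereal_inf [set (objective D x)%:E | x in dro_feasible D].

Definition eps_feasible (R : realType) (n M : nat) (D : dro R n M) (eps : R)
    (x : 'cV[R]_n) : Prop :=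
  decisions D x /\ forall m, (worst_case D m x <= (rhs D m 0 + eps)%:E)%E.

Definition eps_optimal (R : realType) (n M : nat) (D : dro R n M) (eps : R)
    (x : 'cV[R]_n) : Prop :=
  eps_feasible D eps x /\ ((objective D x)%:E <= dro_value D)%E.

(* The domain subspace A carries the topology in which points outside A are
   isolated, so semicontinuity there is semicontinuity on A. *)
Record standing_assumption (R : realType) (n M : nat) (D : dro R n M) :
    Prop := StandingAssumption {
  sa_measurable : forall m (t : 'I_(num_moments D m)),
    measurable_fun (sample_space D m : set (borel R n))
      (moment t : borel R n -> R);
  sa_ambiguity : forall m, ambiguity D m !=set0;
  sa_nonempty : forall m, sample_space D m !=set0;
  sa_closed : forall m, closed (sample_space D m);
  sa_loss_usc : forall m x, decisions D x ->
    upper_semicontinuous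
      (fun a : subspace (sample_space D m) => (loss D m a x)%:E);
  sa_moment_lsc : forall m (t : 'I_(num_moments D m)),
    lower_semicontinuous
      (fun a : subspace (sample_space D m) => (moment t a)%:E);
  sa_growth : forall m x, decisions D x ->
    exists (beta0 : R) (beta : 'I_(num_moments D m) -> R),
      (forall t, 0 <= beta t) /\
      forall a, sample_space D m a ->
        `|loss D m a x| <= beta0 + \sum_t beta t * `|moment t a| }.

Definition ambiguity_on (R : realType) (n M : nat) (D : dro R n M) (m : 'I_M)
    (Ah : set 'cV[R]_n) : set (probability (borel R n) R) :=
  [set P : probability (borel R n) R | ambiguity D m P /\ supp P `<=` Ah].

Definition initial_scenarios (R : realType) (n M : nat) (D : dro R n M)
    (A0 : 'I_M -> set 'cV[R]_n) : Prop :=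
  forall m, [/\ finite_set (A0 m), A0 m `<=` sample_space D m &
                ambiguity_on D m (A0 m) !=set0].

(* For finite Ah, ambiguity_on D m Ah is a compact polytope, so when it is
   nonempty this supremum is a maximum. *)
Definition mp_worst_case (R : realType) (n M : nat) (D : dro R n M) (m : 'I_M)
    (Ah : set 'cV[R]_n) (x : 'cV[R]_n) : \bar R :=
  ereal_sup [set (\sum_(a \in Ah) P [set a] * (loss D m a x)%:E)%E
            | P in ambiguity_on D m Ah].

Definition mp_feasible (R : realType) (n M : nat) (D : dro R n M)
    (Ah : 'I_M -> set 'cV[R]_n) : set 'cV[R]_n :=
  [set x | decisions D x /\
    forall m, (mp_worst_case D m (Ah m) x <= (rhs D m 0)%:E)%E].

Definition mp_solution (R : realType) (n M : nat) (D : dro R n M)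
    (Ah : 'I_M -> set 'cV[R]_n) (x : 'cV[R]_n) : Prop :=
  mp_feasible D Ah x /\
  forall y, mp_feasible D Ah y -> objective D x <= objective D y.

(* An execution of BiCS is given by its answers: at iteration k, the master
   problem solver returns x k and the oracle returns Q k m for each m.  Answers
   at iterations that are not invoked (after termination) are junk. *)
Definition oracle_value (R : realType) (n M : nat) (D : dro R n M)
    (x : nat -> 'cV[R]_n) (Q : nat -> 'I_M -> probability (borel R n) R)
    (k : nat) (m : 'I_M) : \bar R :=
  expect (sample_space D m) (Q k m) (fun a => loss D m a (x k)).

Definition added (R : realType) (n M : nat) (D : dro R n M) (eps : R)
    (x : nat -> 'cV[R]_n) (Q : nat -> 'I_M -> probability (borel R n) R)
    (k : nat) (m : 'I_M) : bool :=
  ((rhs D m 0 + eps / 2)%:E < oracle_value D x Q k m)%E.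

Fixpoint scenarios (R : realType) (n M : nat) (D : dro R n M) (eps : R)
    (A0 : 'I_M -> set 'cV[R]_n)
    (x : nat -> 'cV[R]_n) (Q : nat -> 'I_M -> probability (borel R n) R)
    (k : nat) (m : 'I_M) : set 'cV[R]_n :=
  if k is k'.+1 then
    let Ah := scenarios D eps A0 x Q k' m in
    if added D eps x Q k' m then Ah `|` supp (Q k' m) else Ah
  else A0 m.

Definition stops (R : realType) (n M : nat) (D : dro R n M) (eps : R)
    (x : nat -> 'cV[R]_n) (Q : nat -> 'I_M -> probability (borel R n) R)
    (k : nat) : bool :=
  (\big[Order.max/-oo]_(m < M) (oracle_value D x Q k m - (rhs D m 0)%:E)
     <= (eps / 2)%:E)%E.

Definition invoked (R : realType) (n M : nat) (D : dro R n M) (eps : R)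
    (x : nat -> 'cV[R]_n) (Q : nat -> 'I_M -> probability (borel R n) R)
    (k : nat) : Prop :=
  forall j, (j < k)%N -> ~~ stops D eps x Q j.

Definition terminates_at (R : realType) (n M : nat) (D : dro R n M) (eps : R)
    (x : nat -> 'cV[R]_n) (Q : nat -> 'I_M -> probability (borel R n) R)
    (k : nat) : Prop :=
  invoked D eps x Q k /\ stops D eps x Q k.

Definition oracle_correct (R : realType) (n M : nat) (D : dro R n M) (eps : R)
    (x : nat -> 'cV[R]_n) (Q : nat -> 'I_M -> probability (borel R n) R)
    (k : nat) : Prop :=
  forall m, [/\ ambiguity D m (Q k m), finite_set (supp (Q k m)),
    (worst_case D m (x k) - (eps / 2)%:E <= oracle_value D x Q k m)%E &
    (oracle_value D x Q k m <= worst_case D m (x k))%E].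

(* Main.v *)
(* On termination, the oracle's accuracy eps / 2 and the stopping tolerance
   eps / 2 add up to eps-feasibility; the master problem is a relaxation because
   the expectation under a distribution supported in a finite scenario set is
   the finite sum over that set, so its optimum is at most the DRO value.
   If the algorithm never stopped, the incumbents would have a cluster point y0.
   By compactness of C_m, all scenarios' losses at incumbents close enough to y0
   differ by less than eps / 2.  Take two such incumbents x_i, x_j with i < j,
   and a distribution added at iteration i: it is violated by more than eps / 2
   at x_i, but satisfied at x_j because its support is in the scenario set by
   then, a contradiction. *)
Require Import Defs.
From mathcomp Require Import finmap.
From HB Require Import structures.
From mathcomp Require Import all_boot all_order all_algebra.
From mathcomp Require Import all_classical all_reals all_analysis.
From mathcomp Require Import measurable_realfun.

From mathcomp Require Import lra.

Set Implicit Arguments.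
Unset Strict Implicit.
Unset Printing Implicit Defensive.
Import Order.TTheory GRing.Theory Num.Theory.
Import numFieldNormedType.Exports.
Local Open Scope classical_set_scope.
Local Open Scope ring_scope.

(** * Borel measurability on column vectors *)

Lemma borel_open (R : realType) (n : nat) (U : set 'cV[R]_n) :
  open U -> measurable (U : set (borel R n)).
Proof. exact: sub_sigma_algebra. Qed.

Lemma borel_closed (R : realType) (n : nat) (K : set 'cV[R]_n) :
  closed K -> measurable (K : set (borel R n)).
Proof.
move=> cK; rewrite -(setCK K); apply: measurableC.
by apply: borel_open; exact: closed_openC.
Qed.

Lemma borel_set1 (R : realType) (n : nat) (a : 'cV[R]_n) :
  measurable ([set a] : set (borel R n)).
Proof.
apply: borel_closed; apply: accessible_closed_set1.
by apply: hausdorff_accessible; exact: norm_hausdorff.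
Qed.

(** The rays []-oo, c[] generate the Borel sets, and their preimages are relatively open in [A]. *)
Lemma usc_measurable (R : realType) (n : nat) (A : set 'cV[R]_n)
    (h : 'cV[R]_n -> R) : closed A ->
  upper_semicontinuous (fun a : subspace A => (h a)%:E) ->
  measurable_fun (A : set (borel R n)) (EFin \o h : borel R n -> \bar R).
Proof.
move=> cA usc; apply: (measurability _ (ErealGenInftyO.measurableE R)).
move=> _ [_ [c ->] <-].
(* The implication under [interior] turns relative openness in [A] into an open set of the whole
   space. *)
have -> : A `&` (EFin \o h) @^-1` `]-oo, c%:E[ =
    A `&` interior [set a | A a -> h a < c].
  apply/seteqP; split=> a /= [Aa]; rewrite in_itv /= => ha; split=> //.
  - have [V aV hV] := usc (a : subspace A) c ha.
    move: aV; rewrite /nbhs /= -(nbhs_subspace_in Aa) => aV.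
    have {}aV : nbhs (a : 'cV[R]_n) [set b | A b -> V b] by [].
    rewrite /interior /=; apply: (filterS _ aV) => b Vb /Vb/hV.
    by rewrite lte_fin.
  - by rewrite lte_fin; exact: (interior_subset ha Aa).
apply: measurableI; first exact: borel_closed.
by apply: borel_open; exact: open_interior.
Qed.

(** * Supports and finitely supported distributions *)

Lemma closed_supp (R : realType) (n : nat) (P : probability (borel R n) R) :
  closed (supp P).
Proof.
rewrite -[supp P]setCK; apply: open_closedC; rewrite openE => a.
move=> /= /existsNP[U /not_implyP[[oU Ua] PU0]].
rewrite /interior nbhsE; exists U => // b Ub /(_ U); apply/not_implyP.
by split.
Qed.

Lemma probability_supp (R : realType) (n : nat)
    (P : probability (borel R n) R) : P (~` supp P) = 0%E.
Proof.
(* Open null sets are covered by the countably many null balls whose centre and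
   radius are rational. *)
pose B (i : 'cV[rat]_n * nat) : set 'cV[R]_n :=
  interior (ball (map_mx (ratr : rat -> R) i.1 : 'cV[R]_n) i.2.+1%:R^-1).
(* Indices that code no ball, or a ball of positive mass, contribute [set0]. *)
pose F (k : nat) : set (borel R n) :=
  if unpickle k is Some i then if P (B i) == 0%E then B i else set0 else set0.
have F0 k : P.-negligible (F k).
  rewrite /F; case: unpickle => [i|]; last exact: negligible_set0.
  case: eqP => [Bi0|_]; last exact: negligible_set0.
  by apply/negligibleP => //; by apply: borel_open; exact: open_interior.
have sub : ~` supp P `<=` \bigcup_k F k.
  move=> a /= /existsNP[U /not_implyP[[oU Ua] /negP]].
  rewrite -leNgt => PU0.
  have {PU0} PU0 : P U = 0%E by apply/eqP; rewrite eq_le PU0 measure_ge0.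
  have /nbhs_ballP[e /= e0 aU] : nbhs a U by apply: open_nbhs_nbhs.
  have e20 : 0 < e / 2 by rewrite divr_gt0.
  have [k /= ke] := ltr_add_invr e20.
  have k0 : 0 < k.+1%:R^-1 :> R by rewrite invr_gt0.
  (* A centre within half the radius of [a] puts [a] in the interior of the ball; the radius is
     below [e / 2], so the ball stays within [e] of [a]. *)
  have /choice[q hq] (j : 'I_n) : exists r : rat,
      ratr r \in `](a j 0), (a j 0 + k.+1%:R^-1 / 2)[.
    by apply: rat_in_itvoo; rewrite ltrDl divr_gt0.
  pose i := (\col_j q j : 'cV[rat]_n, k).
  have qa : ball (map_mx (ratr : rat -> R) i.1 : 'cV[R]_n) (k.+1%:R^-1 / 2) a.
    split=> [|j l]; first by rewrite divr_gt0.
    rewrite !mxE (ord1 l) /ball /= ger0_norm ?subr_ge0.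
      by move: (hq j); rewrite in_itv /= ltrBlDl => /andP[].
    by move: (hq j); rewrite in_itv /= => /andP[/ltW].
  have Ba : B i a.
    apply/nbhs_ballP; exists (k.+1%:R^-1 / 2) => /=; first by rewrite divr_gt0.
    by move=> b ab; rewrite (splitr k.+1%:R^-1); exact: ball_triangle qa ab.
  have BU : B i `<=` U.
    apply: subset_trans (@interior_subset _ _) _ => b qb; apply: aU.
    rewrite (splitr e); apply: (@le_ball _ _ _ (k.+1%:R^-1 / 2 + k.+1%:R^-1)).
      rewrite add0r in ke; apply: lerD; last exact: ltW.
      by rewrite (le_trans _ (ltW ke)) // ler_pdivrMr // ler_peMr ?ler1n // ltW.
    exact: ball_triangle (ball_sym qa) qb.
  exists (pickle i) => //; rewrite /F pickleK.
  suff -> : P (B i) == 0%E by [].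
  rewrite -measure_le0 -PU0; apply: le_measure => //; rewrite inE.
    by apply: borel_open; exact: open_interior.
  exact: borel_open.
apply/negligibleP; first by apply: borel_open; exact/closed_openC/closed_supp.
apply: (@negligibleS _ (borel R n) R P _ _ sub); exact: negligible_bigcup.
Qed.

Lemma finite_set_bigcup1 (T : Type) (S : set T) : \bigcup_(a in S) [set a] = S.
Proof. by rewrite bigcup_imset1 image_id. Qed.

Lemma borel_finite (R : realType) (n : nat) (S : set 'cV[R]_n) :
  finite_set S -> measurable (S : set (borel R n)).
Proof.
move=> fS; rewrite -(finite_set_bigcup1 S).
by apply: fin_bigcup_measurable => // a _; exact: borel_set1.
Qed.

Lemma probability_finite_supp (R : realType) (n : nat)
    (P : probability (borel R n) R) (S : set 'cV[R]_n) :
  finite_set S -> supp P `<=` S -> (\sum_(a \in S) P [set a])%E = 1%E.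
Proof.
move=> fS PS; rewrite -measure_fin_bigcup //; first last.
- by move=> a _; exact: borel_set1.
- by move=> a b _ _ [c [-> ->]].
rewrite finite_set_bigcup1; have mS := borel_finite fS.
have : P (~` S) = 0%E.
  apply/eqP; rewrite -measure_le0 -(probability_supp P); apply: le_measure.
  - by rewrite inE; exact: measurableC.
  - by rewrite inE; apply: borel_open; exact/closed_openC/closed_supp.
  - exact: subsetC.
rewrite probability_setC // => /eqP.
by rewrite sube_eq // add0e => /eqP.
Qed.

(** The part of [A] outside [S] misses the support, hence is null; over [S] the integral splits into
    singletons, where [h] is constant. *)
Lemma expect_finite_supp (R : realType) (n : nat)
    (P : probability (borel R n) R) (A S : set 'cV[R]_n) (h : 'cV[R]_n -> R) :
  closed A -> finite_set S -> S `<=` A -> supp P `<=` S ->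
  measurable_fun (A : set (borel R n)) (EFin \o h : borel R n -> \bar R) ->
  expect A P h = (\sum_(a \in S) P [set a] * (h a)%:E)%E.
Proof.
move=> cA fS SA PS mh.
have mA := borel_closed cA; have mS := borel_finite fS.
have mAS : measurable (A `\` S : set (borel R n)) by exact: measurableD.
have AS0 : P (A `\` S) = 0%E.
  apply/eqP; rewrite -measure_le0 -(probability_supp P); apply: le_measure.
  - by rewrite inE.
  - by rewrite inE; apply: borel_open; exact/closed_openC/closed_supp.
  - by move=> a [_ aS] /PS.
rewrite /expect -(setDUK SA) integral_setU //; first last.
- by apply/disj_setPS => a [? []].
- by rewrite (setDUK SA).
rewrite [X in (_ + X)%E]null_set_integral ?adde0 //; last first.
  exact: measurable_funS mh.
rewrite fsbig_finite //= -[in LHS](finite_set_bigcup1 S) -bigsetU_fset_set //.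
rewrite (@integral_bigsetU_EFin _ (borel R n) R P) //; first last.
- rewrite bigsetU_fset_set // finite_set_bigcup1; exact: measurable_funS mh.
- by move=> a b _ _ [c [-> ->]].
- by move=> a; exact: borel_set1.
apply: eq_bigr => a _; rewrite muleC.
rewrite -(@integral_cst _ (borel R n)); last exact: borel_set1.
by apply: eq_integral => b; rewrite inE => ->.
Qed.

(** * Uniform continuity over a compact scenario set *)

(** Compactness in its near-covering form reduces the uniform bound to one on a product
    neighbourhood of each [(a, y0)], where joint continuity gives it. *)
Lemma compact_near_slice (R : realFieldType) (T U : topologicalType)
    (f : T -> U -> R) (A C : set T) (X : set U) (y0 : U) (e : R) :
  compact C -> C `<=` A -> X y0 -> 0 < e ->
  {within A `*` X, continuous (fun ay => f ay.1 ay.2)} ->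
  \forall y \near y0, X y -> forall a, C a -> `|f a y - f a y0| < e.
Proof.
move=> cC CA Xy0 e0 /subspace_continuousP fc.
have e20 : 0 < e / 2 by rewrite divr_gt0.
suff : \forall y \near y0,
    C `<=` [set a | X y -> `|f a y - f a y0| < e].
  by apply: filterS => y Cy Xy a Ca; exact: Cy.
apply: (proj2 (near_covering_withinP C)).
  exact/compact_near_coveringP.
move=> a Ca.
have /fc : (A `*` X) (a, y0) by split=> //; exact: CA.
move=> /cvgrPdist_lt /(_ _ e20).
rewrite /= near_withinE => -[[V W] [Va Wy0] VW].
exists (V, W) => // -[b y] [/= Vb Wy] Cb Xy.
(* Both [f b y] and [f b y0] are compared with the common value [f a y0]. *)
have fby : `|f a y0 - f b y| < e / 2 by apply: (VW (b, y)); split=> //; exact: CA.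
have fby0 : `|f a y0 - f b y0| < e / 2.
  by apply: (VW (b, y0)); split=> //; [exact: nbhs_singleton|exact: CA].
rewrite (splitr e) -(subrK (f a y0) (f b y)) -addrA.
by apply: le_lt_trans (ler_normD _ _) _; rewrite ltrD // distrC.
Qed.

(** * Scenario sets along a run *)

Lemma supp_sub (R : realType) (n : nat) (P : probability (borel R n) R)
    (A : set 'cV[R]_n) : closed A -> P A = 1%E -> supp P `<=` A.
Proof.
move=> cA PA a Pa; apply: contrapT => nAa.
have := Pa (~` A); rewrite probability_setC; last exact: borel_closed.
rewrite PA subee // ltxx => H; suff : false by [].
by apply: H; split=> //; exact: closed_openC.
Qed.

Lemma invokedW (R : realType) (n M : nat) (D : dro R n M) (eps : R)
    (x : nat -> 'cV[R]_n) (Q : nat -> 'I_M -> probability (borel R n) R)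
    (i j : nat) : (i <= j)%N -> invoked D eps x Q j -> invoked D eps x Q i.
Proof. by move=> ij Hj k ki; apply: Hj; exact: leq_trans ij. Qed.

(** Correctness is asked only before iteration [k], since answers after termination are
    arbitrary. *)
Lemma scenarios_finite_sub (R : realType) (n M : nat) (D : dro R n M) (eps : R)
    (A0 : 'I_M -> set 'cV[R]_n)
    (x : nat -> 'cV[R]_n) (Q : nat -> 'I_M -> probability (borel R n) R) k m :
  closed (sample_space D m) -> initial_scenarios D A0 ->
  (forall j, (j < k)%N -> oracle_correct D eps x Q j) ->
  finite_set (scenarios D eps A0 x Q k m) /\
  scenarios D eps A0 x Q k m `<=` sample_space D m.
Proof.
move=> cA hA0; elim: k => [_|k IH HQ] /=; first by have [] := hA0 m.
have [j jk|fS SA] := IH; first by apply: HQ; exact: ltnW.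
have [[QA _] fQ _ _] := HQ k (ltnSn k) m.
case: ifP => _ //; split; first by rewrite finite_setU.
by rewrite subUset; split=> //; exact: supp_sub.
Qed.

Lemma scenarios_mono (R : realType) (n M : nat) (D : dro R n M) (eps : R)
    (A0 : 'I_M -> set 'cV[R]_n)
    (x : nat -> 'cV[R]_n) (Q : nat -> 'I_M -> probability (borel R n) R) m i j :
  (i <= j)%N ->
  scenarios D eps A0 x Q i m `<=` scenarios D eps A0 x Q j m.
Proof.
move=> /subnK <-; elim: (j - i)%N => //= k IH.
by case: ifP => // _; apply: subset_trans IH _; exact: subsetUl.
Qed.

Lemma supp_added_sub (R : realType) (n M : nat) (D : dro R n M) (eps : R)
    (A0 : 'I_M -> set 'cV[R]_n)
    (x : nat -> 'cV[R]_n) (Q : nat -> 'I_M -> probability (borel R n) R) m i j :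
  (i < j)%N -> added D eps x Q i m ->
  supp (Q i m) `<=` scenarios D eps A0 x Q j m.
Proof.
move=> ij Qi; apply: subset_trans; last exact: scenarios_mono ij.
by rewrite /= Qi; exact: subsetUr.
Qed.

(** * Relaxation, stopping test and violated scenarios *)

Lemma mp_worst_case_le (R : realType) (n M : nat) (D : dro R n M) (m : 'I_M)
    (Ah : set 'cV[R]_n) (x : 'cV[R]_n) :
  standing_assumption D -> decisions D x ->
  finite_set Ah -> Ah `<=` sample_space D m ->
  (mp_worst_case D m Ah x <= worst_case D m x)%E.
Proof.
move=> hD Xx fA AA; apply/ereal_supP => _ [P [DP PA] <-].
apply: ereal_sup_ubound; exists P => //.
have cA := sa_closed hD (m := m).
apply: expect_finite_supp => //.
by apply: usc_measurable => //; exact: sa_loss_usc.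
Qed.

(** The run stops exactly when nothing is added. For [M = 0] the maximum is its default [-oo], so
    the test passes. *)
Lemma stopsE (R : realType) (n M : nat) (D : dro R n M) (eps : R)
    (x : nat -> 'cV[R]_n) (Q : nat -> 'I_M -> probability (borel R n) R)
    (k : nat) :
  stops D eps x Q k = [forall m, ~~ added D eps x Q k m].
Proof.
apply/idP/forallP => [sk m|ak].
  rewrite /added -leNgt addrC EFinD -leeBlDr //; apply: le_trans sk.
  exact: (le_bigmax_cond _ (fun m => _ - _)%E).
apply/bigmax_leP; split=> [|m _]; first exact: leNye.
by move: (ak m); rewrite /added -leNgt addrC EFinD -leeBlDr.
Qed.

(* The master problem at a later iteration already contains the support of the
   added distribution, which therefore certifies a violation of at most 0
   there, against more than eps / 2 at the earlier incumbent. *)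
Lemma added_loss_gap (R : realType) (n M : nat) (D : dro R n M) (eps : R)
    (A0 : 'I_M -> set 'cV[R]_n)
    (x : nat -> 'cV[R]_n) (Q : nat -> 'I_M -> probability (borel R n) R) m i j :
  standing_assumption D -> initial_scenarios D A0 ->
  (forall k, (k < j)%N -> oracle_correct D eps x Q k) ->
  decisions D (x i) -> mp_feasible D (scenarios D eps A0 x Q j) (x j) ->
  (i < j)%N -> added D eps x Q i m ->
  ~ (forall a, supp (Q i m) a ->
       loss D m a (x i) <= loss D m a (x j) + eps / 2).
Proof.
move=> hD hA0 HQ Xi [Xj fj] ij Qi le_loss.
have cA := sa_closed hD (m := m).
have ml y : decisions D y -> measurable_fun (sample_space D m : set (borel R n))
    (EFin \o loss D m ^~ y : borel R n -> \bar R).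
  by move=> Xy; apply: usc_measurable => //; exact: sa_loss_usc.
have [QA fS _ _] := HQ i ij m.
have SA : supp (Q i m) `<=` sample_space D m by apply: supp_sub => //; case: QA.
have [fA AA] := scenarios_finite_sub cA hA0 HQ.
have SAj := supp_added_sub A0 ij Qi.
have le_rhs :
    (expect (sample_space D m) (Q i m) (loss D m ^~ (x j)) <= (rhs D m 0)%:E)%E.
  apply: le_trans (fj m); apply: ereal_sup_ubound; exists (Q i m) => //.
  by apply: esym; apply: expect_finite_supp => //; exact: ml.
have : ((rhs D m 0 + eps / 2)%:E < oracle_value D x Q i m)%E := Qi.
apply/negP; rewrite -leNgt /oracle_value.
rewrite (expect_finite_supp cA fS) //; last exact: ml.
rewrite EFinD; apply: le_trans (leeD2r _ le_rhs).
rewrite (expect_finite_supp cA fS) //; last exact: ml.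
(* Spreading [eps / 2] over the atoms, whose masses sum to 1, makes the inequality termwise. *)
rewrite -[X in (_ <= _ + X)%E]mule1.
rewrite -(probability_finite_supp fS (@subset_refl _ _)).
rewrite ge0_mule_fsumr // -fsbig_split //=.
apply: lee_fsum => // a Sa.
have Pa : Q i m [set a] \is a fin_num.
  by apply: fin_num_measure; exact: borel_set1.
rewrite [((eps / 2)%:E * _)%E]muleC -muleDr //.
by apply: lee_wpmul2l => //; rewrite -EFinD lee_fin le_loss.
Qed.

(** * Optimality on return and finite termination *)

Lemma terminates_or_invoked (R : realType) (n M : nat) (D : dro R n M) (eps : R)
    (x : nat -> 'cV[R]_n) (Q : nat -> 'I_M -> probability (borel R n) R) :
  ~ (exists k, terminates_at D eps x Q k) -> forall k, invoked D eps x Q k.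
Proof.
move=> nT; elim=> [|k IH] j; first by [].
rewrite ltnS leq_eqVlt => /predU1P[->|]; last exact: IH.
by apply/negP => sk; apply: nT; exists k.
Qed.

Theorem theorem4 (R : realType) (n M : nat) (D : dro R n M) (eps : R)
    (A0 : 'I_M -> set 'cV[R]_n)
    (x : nat -> 'cV[R]_n) (Q : nat -> 'I_M -> probability (borel R n) R)
    (hD : standing_assumption D) (heps : 0 < eps)
    (hA0 : initial_scenarios D A0)
    (hvalue : dro_value D \is a fin_num)
    (hattained : forall k, invoked D eps x Q k ->
       exists y, mp_solution D (scenarios D eps A0 x Q k) y)
    (hincumbent : forall k, invoked D eps x Q k ->
       mp_solution D (scenarios D eps A0 x Q k) (x k))
    (horacle : forall k, invoked D eps x Q k ->
       oracle_correct D eps x Q k) :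
  (forall k, terminates_at D eps x Q k -> eps_optimal D eps (x k)) /\
  (compact (decisions D) ->
   (forall m, {within sample_space D m `*` decisions D,
      continuous (fun ax => loss D m ax.1 ax.2)}) ->
   (exists C : 'I_M -> set 'cV[R]_n,
      (forall m, compact (C m) /\ C m `<=` sample_space D m) /\
      (forall k m, invoked D eps x Q k -> added D eps x Q k m ->
         supp (Q k m) `<=` C m)) ->
   exists k, terminates_at D eps x Q k).
Proof.
have decisionsx k : invoked D eps x Q k -> decisions D (x k).
  by move=> /hincumbent[[]].
split=> [k [Ik sk]|cX fc [C [hC QC]]].
  have [[Xk fk] opt] := hincumbent k Ik.
  split.
    split=> // m; have [_ _ low _] := horacle k Ik m.
    move: sk; rewrite stopsE => /forallP/(_ m); rewrite /added -leNgt => up.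
    by have := le_trans low up; rewrite leeBlDr // -EFinD -addrA -splitr.
  (* Each DRO-feasible [y] is feasible for the current master problem, which [x k] solves. *)
  apply/ereal_infP => _ [y [Xy fy] <-]; rewrite lee_fin; apply: opt.
  split=> // m; apply: le_trans (fy m).
  have [j jk|fS SA] := @scenarios_finite_sub _ _ _ D eps A0 x Q k m
    (sa_closed hD (m := m)) hA0.
    by apply: horacle; apply: invokedW Ik; exact: ltnW.
  exact: mp_worst_case_le.
apply: contrapT => /terminates_or_invoked Iall.
have [y0 [Xy0 cly0]] : decisions D `&` cluster (x @ \oo) !=set0.
  by apply: cX; exists 0%N => // k _; exact: decisionsx.
(* Two incumbents, each within [eps / 4] of [y0] in loss, differ by less than the [eps / 2] of the
   addition threshold. *)
have e40 : 0 < eps / 4 by rewrite divr_gt0.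
pose V : set 'cV[R]_n := [set y | forall m, decisions D y ->
  forall a, C m a -> `|loss D m a y - loss D m a y0| < eps / 4].
have nV : nbhs y0 V.
  (* Finitely many [m], so one neighbourhood of [y0] serves them all. *)
  apply: (@filter_forall _ _ _ (nbhs y0)) => m; have [cC CA] := hC m.
  exact: (compact_near_slice cC CA Xy0 e40 (fc m)).
(* A cluster point's neighbourhood meets every tail of the sequence, so no convergent subsequence
   need be extracted. *)
have visit N : exists2 k, (N <= k)%N & V (x k).
  have : (x @ \oo) [set x k | k in [set k | (N <= k)%N]].
    by exists N => // k /= Nk; exists k.
  by move=> /cly0/(_ nV)[_ [[k Nk <-] Vk]]; exists k.
have [i _ Vi] := visit 0%N; have [j ij Vj] := visit i.+1.
have [m Qi] : exists m, added D eps x Q i m.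
  have := Iall i.+1 i (ltnSn i); rewrite stopsE negb_forall => /existsP[m].
  by rewrite negbK; exists m.
have [feasj _] := hincumbent j (Iall j).
apply: (added_loss_gap hD hA0 _ (decisionsx i (Iall i)) feasj ij Qi) => [k _|a Sa].
  exact: horacle.
have Ca := QC i m (Iall i) Qi a Sa.
have := Vi m (decisionsx i (Iall i)) a Ca.
have := Vj m (decisionsx j (Iall j)) a Ca.
rewrite !ltr_distl => /andP[lj _] /andP[_ ui].
lra.
Qed.
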